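(* There exist a rooted directed tree $(V,E)$ and a weighted shift on $c_0(V)$ that is mixing but not chaotic. Consequently, for $J\in\{\mathbb{N},\mathbb{Z}\}$, there exist a Banach space $X$ and an operator $T\in L(X)$ such that $B_T$ is mixing on $c_0(X,J)$ but not chaotic on $c_0(X,J)$.
   Context: $\mathbb{N}=\{1,2,\dots\}$; $L(X)$ denotes the bounded linear operators on $X$. A rooted directed tree $(V,E)$ is a countable directed graph with a distinguished vertex (the root) such that every vertex $v$ is reached from the root by a unique directed path; every $v$ other than the root has a unique parent $\mathrm{par}(v)$, and $\mathrm{Chi}(v)$ denotes the (possibly infinite) set of children of $v$. $c_0(V)$ is the space of scalar families on $V$ vanishing at infinity (for every $\varepsilon>0$ only finitely many entries have modulus $\ge\varepsilon$), with sup norm and canonical unit vectors $(e_v)_{v\in V}$. Given non-zero scalar weights $(\lambda_v)$, the weighted (backward) shift on $c_0(V)$ is the operator $(x_v)_{v\in V}\mapsto\big(\sum_{u\in\mathrm{Chi}(v)}\lambda_u x_u\big)_{v\in V}$, assumed to be a bounded operator on $c_0(V)$ (so $e_u\mapsto\lambda_ue_{\mathrm{par}(u)}$ if $u$ is not the root, and $e_{\mathrm{root}}\mapsto 0$). $c_0(X,J)$ is the Banach space of families $(x_k)_{k\in J}$ in $X$ with $\lim_{|k|\to\infty}\|x_k\|=0$ (sup norm), and $B_T(x_k)_{k\in J}=(Tx_{k+1})_{k\in J}$. An operator $S$ on a Banach space $Y$ is mixing if for all non-empty open sets $U,W\subset Y$ the set $\{n\ge 0:S^nU\cap W\neq\emptyset\}$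 is cofinite; it is chaotic if it is hypercyclic (some $y\in Y$ has dense orbit $\{S^ny:n\ge 0\}$) and its set of periodic points (those $y$ with $S^dy=y$ for some $d\ge1$) is dense in $Y$. *)

(* Defs.v *)
From HB Require Import structures.
From mathcomp Require Import all_boot all_order all_algebra.
From mathcomp Require Import finmap complex.
From mathcomp Require Import boolp classical_sets functions cardinality reals.
From mathcomp Require Import topology normedtype summability.

Set Implicit Arguments.
Unset Strict Implicit.
Unset Printing Implicit Defensive.

Import Order.TTheory GRing.Theory Num.Theory.
Import numFieldNormedType.Exports.

Local Open Scope classical_set_scope.
Local Open Scope ring_scope.

Section C0.
Context {K : numFieldType} {I : choiceType} {X : normedModType K}.

Definition vanishing (x : I -> X) : Prop :=
  forall e : K, 0 < e -> finite_set [set i | e <= `|x i|].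

Definition c0_pred : {pred (I -> X)} := fun x => `[< vanishing x >].

Lemma c0_submod_closed : submod_closed c0_pred.
Proof.
split=> [|a x y /asboolP xP /asboolP yP]; apply/asboolP => e e0.
  apply: (sub_finite_set _ (@finite_set0 I)) => i /=.
  by rewrite normr0 => /(lt_le_trans e0); rewrite ltxx.
have a0 : 0 < `|a| + 1 by rewrite ltr_wpDl.
apply: (@sub_finite_set _ _ ([set i | e / 2 / (`|a| + 1) <= `|x i|] `|`
                             [set i | e / 2 <= `|y i|])); last first.
  by rewrite finite_setU; split; [apply: xP|apply: yP]; rewrite !divr_gt0.
move=> i /= ei; apply: contrapT => /not_orP[/negP xi /negP yi].
move: xi yi; rewrite -!real_ltNge ?ger0_real ?divr_ge0 ?(ltW e0) ?(ltW a0)//.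
rewrite ltr_pdivlMr// => xi yi.
have : `|a *: x i + y i| < e.
  rewrite (le_lt_trans (ler_normD _ _))// [ltRHS](splitr e) ltrD// normrZ.
  by rewrite (le_lt_trans _ xi)// mulrC ler_wpM2l// lerDl.
by move=> /(le_lt_trans ei); rewrite ltxx.
Qed.

HB.instance Definition _ :=
  GRing.isSubmodClosed.Build K (I -> X) c0_pred c0_submod_closed.

Record c0 : Type := C0 { c0_fun :> I -> X; _ : c0_fun \in c0_pred }.

HB.instance Definition _ := [isSub for c0_fun].
HB.instance Definition _ := [Choice of c0 by <:].
HB.instance Definition _ := [SubChoice_isSubLmodule of c0 by <:].

(* [K] may be R[i], whose order is only partial; the supremum exists there too,
   the moduli being comparable and their maximum being attained
   ([c0_argmax], [c0_norm_attained]). *)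
Definition c0_norm (x : c0) : K := supremum 0 (range (fun i => `|x i|)).

Lemma c0P (x : c0) : vanishing x.
Proof. exact/asboolP/(valP x). Qed.

Lemma seq_argmax (f : I -> K) (i0 : I) (s : seq I) : (forall i, 0 <= f i) ->
  exists i, forall j, j \in i0 :: s -> f j <= f i.
Proof.
move=> f0; elim: s => [|k s [i IH]].
  by exists i0 => j; rewrite inE => /eqP ->.
have [ki|ik] := real_leP (ger0_real (f0 k)) (ger0_real (f0 i)).
  exists i => j; rewrite !inE => /or3P[/eqP->|/eqP->//|js].
    by rewrite IH// mem_head.
  by rewrite IH// inE js orbT.
exists k => j; rewrite !inE => /or3P[/eqP->|/eqP->//|js].
  by rewrite (le_trans _ (ltW ik))// IH// mem_head.
by rewrite (le_trans _ (ltW ik))// IH// inE js orbT.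
Qed.

Lemma c0_argmax (x : c0) (i0 : I) : exists i, forall j, `|x j| <= `|x i|.
Proof.
have [x0|/existsNP[i1 /eqP xi1]] := pselect (forall i, x i = 0).
  by exists i0 => j; rewrite !x0.
have xi1_gt0 : 0 < `|x i1| by rewrite normr_gt0.
have /finite_seqP[s sE] := c0P x xi1_gt0.
have [i iP] := seq_argmax i1 s (fun i => normr_ge0 (x i)).
exists i => j; have [xj|] := real_leP (normr_real (x i1)) (normr_real (x j)).
  by apply: iP; rewrite inE; apply/orP; right;
    have : [set` s] j by rewrite -sE.
by move/ltW/le_trans; apply; apply: iP; rewrite mem_head.
Qed.

Lemma c0_norm_attained (x : c0) (i : I) :
  (forall j, `|x j| <= `|x i|) -> c0_norm x = `|x i|.
Proof.
move=> xi; rewrite /c0_norm /supremum ifF; last first.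
  by apply/negP => /eqP/seteqP[/(_ `|x i|)] h _; apply: h; exists i.
have sx : supremums (range (fun j => `|x j|)) `|x i|.
  by split=> [_ [j _ <-]//|y]; apply; exists i.
by apply: xget_subset1 => //; exact: is_subset1_supremums.
Qed.

Lemma c0_norm_empty (x : c0) : ~ ([set: I] !=set0) -> c0_norm x = 0.
Proof.
move=> I0; rewrite /c0_norm.
suff -> : range (fun i => `|x i|) = set0 by exact: supremum0.
by rewrite -subset0 => t [i _ _]; apply: I0; exists i.
Qed.

Lemma c0_norm_ge (x : c0) (i : I) : `|x i| <= c0_norm x.
Proof. by have [j xj] := c0_argmax x i; rewrite (c0_norm_attained xj). Qed.

Lemma c0_norm_le (x : c0) (M : K) :
  0 <= M -> (forall i, `|x i| <= M) -> c0_norm x <= M.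
Proof.
move=> M0 xM; have [[i _]|I0] := pselect ([set: I] !=set0).
  by have [j xj] := c0_argmax x i; rewrite (c0_norm_attained xj).
by rewrite c0_norm_empty.
Qed.

Lemma c0_norm_ge0 (x : c0) : 0 <= c0_norm x.
Proof.
have [[i _]|I0] := pselect ([set: I] !=set0).
  exact: le_trans (c0_norm_ge x i).
by rewrite c0_norm_empty.
Qed.

Lemma c0_eqP (x y : c0) : (forall i, x i = y i) -> x = y.
Proof. by move=> xy; apply/val_inj/funext. Qed.

Lemma c0_norm0_eq0 (x : c0) : c0_norm x = 0 -> x = 0.
Proof.
move=> x0; apply: c0_eqP => i; apply/eqP; rewrite -normr_le0 -x0.
exact: c0_norm_ge.
Qed.

Lemma c0_normD (x y : c0) : c0_norm (x + y) <= c0_norm x + c0_norm y.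
Proof.
apply: c0_norm_le => [|i]; first by rewrite addr_ge0 ?c0_norm_ge0.
by rewrite (le_trans (ler_normD _ _))// lerD// c0_norm_ge.
Qed.

Lemma c0_normZ (a : K) (x : c0) : c0_norm (a *: x) = `|a| * c0_norm x.
Proof.
have [[i _]|I0] := pselect ([set: I] !=set0).
  have [j xj] := c0_argmax x i; rewrite (c0_norm_attained xj).
  rewrite (@c0_norm_attained _ j) => [|k] /=; first exact: normrZ.
  by rewrite [leLHS]normrZ [leRHS]normrZ ler_wpM2l.
by rewrite !c0_norm_empty// mulr0.
Qed.

HB.instance Definition _ :=
  Lmodule_isNormed.Build K c0 c0_normD c0_normZ c0_norm0_eq0.

End C0.
Arguments c0 {K} I X.

Section C0Complete.
Context {K : numFieldType} {I : choiceType} {X : completeNormedModType K}.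

Lemma c0_complete (F : set_system (c0 I X)) :
  ProperFilter F -> cauchy F -> cvg F.
Proof.
move=> FF /cauchy_ballP Fc.
have Fi i : cauchy ((fun x : c0 I X => x i) @ F).
  apply/cauchy_ballP => e e0; rewrite near_map2.
  have := Fc e e0; apply: filterS => -[x y] /=.
  rewrite -!ball_normE /ball_ /= => xy; apply: le_lt_trans xy.
  exact: (@c0_norm_ge _ _ _ (x - y)).
have Fcvg i : (fun x : c0 I X => x i) @ F --> lim ((fun x : c0 I X => x i) @ F).
  exact: cauchy_cvg (Fi i).
pose L i := lim ((fun x : c0 I X => x i) @ F).
have FL e : 0 < e -> F [set x : c0 I X | forall i, `|L i - x i| <= e].
  move=> e0; have e20 : 0 < e / 2 by rewrite divr_gt0.
  near=> x => i; near F => y.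
  rewrite -(subrK (y i) (L i)) -addrA (le_trans (ler_normD _ _))//.
  rewrite [leRHS](splitr e) lerD//.
    by near: y; apply: (@cvgr_dist_le _ _ _ F _ _ _ (Fcvg i)).
  apply: (le_trans (@c0_norm_ge _ _ _ (y - x) i)); apply: ltW.
  have : ball x (e / 2) y.
    by near: y; near: x; apply: nearP_dep; exact: Fc.
  by move=> /ball_sym; rewrite -ball_normE.
have L0 : L \in @c0_pred K I X.
  apply/asboolP => e e0; have e20 : 0 < e / 2 by rewrite divr_gt0.
  near F => x.
  apply: sub_finite_set (c0P x e20) => i /= eL.
  have Lx : `|L i - x i| <= e / 2 by move: i {eL}; near: x; exact: FL.
  rewrite -(lerD2l (e / 2)) -splitr (le_trans eL)//.
  rewrite -(subrK (x i) (L i)) (le_trans (ler_normD _ _))// lerD//.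
apply/cvg_ex; exists (C0 L0 : c0 I X).
apply/cvgrPdist_le => e e0; near=> x.
apply: c0_norm_le => [|i]; first exact: ltW.
by move: i; near: x; exact: FL.
Unshelve. all: by end_near.
Qed.

HB.instance Definition _ := Uniform_isComplete.Build (c0 I X) c0_complete.

End C0Complete.

Section C0Index.
Context {K : numFieldType} {X : normedModType K}.

Lemma vanishing_at_infty (I : choiceType) (h : I -> nat) (x : I -> X) :
  (forall N, finite_set [set i | (h i <= N)%N]) ->
  vanishing x <->
  (forall e : K, 0 < e -> exists N, forall i, (N < h i)%N -> `|x i| < e).
Proof.
move=> hfin; split=> [xP e e0|xP e e0].
  have /finite_seqP[s sE] := xP e e0.
  exists (\max_(i <- s) h i)%N => i hi.
  rewrite real_ltNge ?ger0_real ?(ltW e0)//; apply/negP => ei.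
  have si : i \in s by have : [set` s] i by rewrite -sE.
  by move: hi; rewrite ltnNge (@leq_bigmax_seq _ s xpredT h i si).
have [N NP] := xP e e0; apply: sub_finite_set (hfin N) => i /= ei.
rewrite leqNgt; apply/negP => /NP /(le_lt_trans ei).
by rewrite ltxx.
Qed.

Lemma vanishing_intP (x : int -> X) : vanishing x <->
  (forall e : K, 0 < e -> exists N, forall k, (N < `|k|)%N -> `|x k| < e).
Proof.
apply: vanishing_at_infty => N; apply/finite_seqP.
pose r := [seq Posz n | n <- iota 0 N.+1].
pose s := [seq - Posz n | n <- iota 0 N.+1].
exists (r ++ s); apply/seteqP; split=> [k kN|k].
  have kI : `|k|%N \in iota 0 N.+1 by rewrite mem_iota add0n ltnS.
  rewrite /mkset mem_cat; apply/orP.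
  case: k kN kI => n _ nI; [left|right]; apply/mapP; first by exists n.
  by exists n.+1; rewrite ?NegzE.
rewrite /mkset mem_cat => /orP[] /mapP[n]; rewrite mem_iota add0n ltnS => nN ->;
  by rewrite ?abszN.
Qed.

(* The index set of the positive integers {1, 2, ...}. *)
Definition pnat : Type := {n : nat | (0 < n)%N}.

Lemma vanishing_pnatP (x : pnat -> X) : vanishing x <->
  (forall e : K, 0 < e -> exists N, forall k, (N < val k)%N -> `|x k| < e).
Proof.
apply: vanishing_at_infty => N; apply/finite_seqP.
exists (pmap insub (iota 0 N.+1)).
by apply/seteqP; split=> k; rewrite /mkset mem_pmap_sub mem_iota add0n ltnS.
Qed.

End C0Index.

Definition pnat_succ (k : pnat) : pnat :=
  exist (fun n : nat => (0 < n)%N) (val k).+1 isT.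

Lemma pnat_succ_inj : injective pnat_succ.
Proof. by move=> j k [jk]; apply: val_inj. Qed.

Definition int_succ (k : int) : int := k + 1.

Lemma int_succ_inj : injective int_succ.
Proof. exact: addIr. Qed.

Section OperatorWeightedShift.
Context {K : numFieldType} {X : normedModType K} {J : choiceType}.
Variables (succ : J -> J) (succ_inj : injective succ).
Variables (T : {linear X -> X}) (T_bounded : bounded_near T (nbhs (0 : X))).

Lemma BT_subproof (x : c0 J X) : (fun k => T (x (succ k))) \in @c0_pred K J X.
Proof.
apply/asboolP => e e0.
have /linear_boundedP/pinfty_ex_gt0[r r0 Tr] := T_bounded.
have : finite_set (succ @^-1` [set k | e / r <= `|x k|]).
  apply: finite_preimage; last by apply: c0P; rewrite divr_gt0.
  by move=> j k _ _; apply: succ_inj.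
apply: sub_finite_set => k /= ek.
by rewrite ler_pdivrMr// mulrC (le_trans ek).
Qed.

Definition BT (x : c0 J X) : c0 J X := C0 (BT_subproof x).

End OperatorWeightedShift.

Section Dynamics.
Context {Y : topologicalType}.
Implicit Types (S : Y -> Y).

Definition mixing S : Prop :=
  forall U W : set Y, open U -> U !=set0 -> open W -> W !=set0 ->
    finite_set (~` [set n | iter n S @` U `&` W !=set0]).

Definition hypercyclic S : Prop :=
  exists y, dense [set iter n S y | n in [set: nat]].

Definition periodic S : set Y :=
  [set y | exists2 d, (0 < d)%N & iter d S y = y].

Definition chaotic S : Prop := hypercyclic S /\ dense (periodic S).

End Dynamics.

(* The relation [path] allows repeated vertices, so that uniqueness excludes
   circuits: every vertex but the root has exactly one parent and the root has
   none. *)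
Definition rooted_directed_tree (V : countType) (E : rel V) (root : V) : Prop :=
  forall v, exists! p : seq V, path E root p /\ last root p = v.

(* As the children of v carry no order, the sum over them is the limit of the
   net of finite partial sums. *)
Definition weighted_shift (K : numFieldType) (V : countType) (E : rel V)
    (lambda : V -> K) (S : c0 V K^o -> c0 V K^o) : Prop :=
  forall (x : c0 V K^o) (v : V),
    partial_sum (fun u => if E v u then lambda u * x u else 0) A
      @[A --> totally] --> S x v.

(* Main.v *)
(* The tree is the full binary tree and the weights are read off an automaton
   that starts in state A(0).  In state A(k) one child is in state A(k+1)
   (weight 1/4) and the other starts a climb B(k,3k+3) (weight 1); in state
   B(k,m), m > 0, one child is in state B(k,m-1) (weight 2), while all other
   children below a B-state are reset to A(0) with the tiny weight
   2^-(3k+7).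

   Mixing: below a vertex in state A(0), take k = n %/ 4 steps along the
   A-states and then climb; the climb k lasts long enough for the product of
   the n+1 weights on this path to be at least 2^(n %/ 4), so every unit vector
   has arbitrarily small n-th preimages.

   No chaos: a periodic point x yields a bounded sequence with z_0 = x and
   z_n = S z_(n+1).  If D bounds all z_n at all A-vertices, then |z_n| is at
   most 2^(m+2) 2^-(3k+7) D at B(k,m), hence at most D/4 at B(k,3k+3), hence at
   most D/4 + D/4 = D/2 at the A-vertices.  Iterating, the z_n vanish at the
   A-vertices, in particular at the root, so periodic points are not dense.
   For a periodic point y of B_T, T = S, the same applies to the sequence of
   the coordinates j+n of the n-th term of its backward orbit. *)
Require Import Defs.
From HB Require Import structures.
From mathcomp Require Import all_boot all_order all_algebra.
From mathcomp Require Import finmap complex.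
From mathcomp Require Import boolp classical_sets functions cardinality reals.
From mathcomp Require Import topology normedtype summability.
From mathcomp Require Import ring zify.

Set Implicit Arguments.
Unset Strict Implicit.
Unset Printing Implicit Defensive.

Import Order.TTheory GRing.Theory Num.Theory.
Import numFieldNormedType.Exports.

Local Open Scope classical_set_scope.
Local Open Scope ring_scope.

(** * A criterion for mixing *)

(** The two halves of a Kitai-type criterion; the preimage [w] may depend on [n] and [e], so no
    right inverse of [S] is fixed. *)
Definition null_and_reachable {K : numFieldType} {Y : normedModType K}
    (S : Y -> Y) (y : Y) : Prop :=
  (exists N, forall n, (N <= n)%N -> iter n S y = 0) /\
  (forall e : K, 0 < e -> exists N, forall n, (N <= n)%N ->
     exists2 w, `|w| < e & iter n S w = y).

Section MixingCriterion.
Context {K : numFieldType} {Y : normedModType K}.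
Variable S : Y -> Y.
Hypothesis SD : {morph S : x y / x + y}.

Let iterSD n : {morph iter n S : x y / x + y}.
Proof. by elim: n => [|n IH] x y //=; rewrite IH SD. Qed.

Let iterS0 n : iter n S 0 = 0.
Proof. by apply: (addrI (iter n S 0)); rewrite -iterSD !addr0. Qed.

Lemma null_and_reachable0 : null_and_reachable S 0.
Proof.
split=> [|e e0]; exists 0%N => n _; first exact: iterS0.
by exists 0; rewrite ?normr0 ?iterS0.
Qed.

Lemma null_and_reachableD x y : null_and_reachable S x ->
  null_and_reachable S y -> null_and_reachable S (x + y).
Proof.
move=> [[N xN] xR] [[M yM] yR]; split=> [|e e0].
  exists (maxn N M) => n; rewrite geq_max => /andP[Nn Mn].
  by rewrite iterSD xN// yM// addr0.
have e20 : 0 < e / 2 by rewrite divr_gt0.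
have [N' xN'] := xR _ e20; have [M' yM'] := yR _ e20.
exists (maxn N' M') => n; rewrite geq_max => /andP[Nn Mn].
have [w we wx] := xN' n Nn; have [w' we' wy] := yM' n Mn.
exists (w + w'); last by rewrite iterSD wx wy.
by rewrite (le_lt_trans (ler_normD _ _))// [ltRHS](splitr e) ltrD.
Qed.

(** If [x] in U is null and [w] is a small n-th preimage of [y] in W, then [x + w] lies in U and
    [iter n S] sends it to [y]. *)
Lemma mixing_criterion : dense [set y | null_and_reachable S y] -> mixing S.
Proof.
move=> dS U W Uo U0 Wo W0.
have [x [Ux [[N xN] _]]] := dS U U0 Uo.
have [y [Wy [_ yR]]] := dS W W0 Wo.
have /nbhs_ballP[e /= e0 eU] : nbhs x U by exact: open_nbhs_nbhs.
have [M yM] := yR e e0.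
apply: (@sub_finite_set _ _ `I_(maxn N M)); last exact: finite_II.
move=> n /= nUW; rewrite ltnNge; apply/negP.
rewrite geq_max => /andP[Nn Mn]; apply: nUW.
have [w we wy] := yM n Mn; exists y; split=> //.
exists (x + w); last by rewrite iterSD xN// add0r.
by apply: eU; rewrite -ball_normE /ball_/= opprD addrA subrr add0r normrN.
Qed.

End MixingCriterion.

(** * Vectors supported on one coordinate, and density *)

Section Delta.
Context {K : numFieldType} {I : choiceType} {X : normedModType K}.

Lemma delta_subproof (i : I) (x : X) :
  (fun j => if j == i then x else 0) \in @c0_pred K I X.
Proof.
apply/asboolP => e e0; apply: (@sub_finite_set _ _ [set i]);
  last exact: finite_set1.
move=> j /=; case: eqVneq => // _; rewrite normr0 => /(lt_le_trans e0).
by rewrite ltxx.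
Qed.

Definition delta (i : I) (x : X) : c0 I X := C0 (delta_subproof i x).

Lemma deltaE i x j : delta i x j = if j == i then x else 0.
Proof. by []. Qed.

Lemma delta_norm i x : `|delta i x| = `|x|.
Proof.
have dii : delta i x i = x by rewrite deltaE eqxx.
rewrite [LHS](@c0_norm_attained _ _ _ _ i) ?dii// => j.
by rewrite deltaE; case: ifP => // _; rewrite normr0.
Qed.

Lemma c0_coord_lt (x y : c0 I X) e i : ball x e y -> `|x i - y i| < e.
Proof.
by rewrite -ball_normE /ball_ /=; apply: le_lt_trans;
  exact: (c0_norm_ge (x - y)).
Qed.

Lemma dense_c0 (D : set (c0 I X)) :
  D 0 -> (forall x y, D x -> D y -> D (x + y)) ->
  (forall i x (e : K), 0 < e -> exists2 x', `|x - x'| < e & D (delta i x')) ->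
  dense D.
Proof.
move=> D0 DD Ddelta O [z Oz] Oo.
have /nbhs_ballP[e /= e0 eO] : nbhs z O by exact: open_nbhs_nbhs.
have e20 : 0 < e / 2 by rewrite divr_gt0.
have /finite_seqP[s sE] := c0P z e20.
(* Only the finitely many large entries of [z] are approximated; elsewhere [y] is kept 0. *)
have [y Dy yz] : exists2 y, D y &
    forall j, if j \in s then is_true (`|z j - y j| < e / 2) else y j = 0.
  elim: s {sE} => [|i s [y Dy yz]]; first by exists 0.
  have [si|si] := boolP (i \in s).
    exists y => // j; rewrite inE; case: eqVneq => [->|_]; last exact: yz.
    by move: (yz i); rewrite si.
  have [x' x'e Dx'] := Ddelta i (z i) _ e20.
  exists (delta i x' + y); first exact: DD.
  move=> j; rewrite inE.
  have -> : (delta i x' + y) j = delta i x' j + y j by [].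
  rewrite deltaE; case: eqVneq => [->|_] /=; last by rewrite add0r; exact: yz.
  by move: (yz i); rewrite (negPf si) => ->; rewrite addr0.
exists y; split=> //; apply: eO; rewrite -ball_normE /ball_ /=.
apply: (@le_lt_trans _ _ (e / 2)); last by rewrite gtr_pMr// invf_lt1// ltr1n.
apply: c0_norm_le => [|j]; first exact: ltW.
have -> : (z - y) j = z j - y j by [].
move: (yz j); case: ifPn => [_ /ltW//|sj ->]; rewrite subr0.
rewrite ltW// real_ltNge ?ger0_real ?(ltW e20)//; apply/negP => ej.
by move/negP: sj; apply; have : [set` s] j by rewrite -sE.
Qed.

End Delta.

(** * Mixing passes from the criterion for [T] to [BT] *)

Section BTMixing.
Context {K : numFieldType} {X : normedModType K} {J : choiceType}.
Variables (succ : J -> J) (succ_inj : injective succ).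
Variables (T : {linear X -> X}) (T_bounded : bounded_near T (nbhs (0 : X))).

Local Notation B := (BT succ_inj T_bounded).

Lemma BTD : {morph B : x y / x + y}.
Proof. by move=> x y; apply: c0_eqP => j; rewrite /= linearD. Qed.

Lemma iter_BT n (x : c0 J X) j : iter n B x j = iter n T (x (iter n succ j)).
Proof. by elim: n j => //= n IH j; rewrite IH -iterSr iterS. Qed.

Lemma iter_BT_delta n x j :
  iter n B (delta (iter n succ j) x) = delta j (iter n T x).
Proof.
have iter_inj : injective (iter n succ).
  by elim: n => //= n IH i k /succ_inj; exact: IH.
apply: c0_eqP => i; rewrite iter_BT !deltaE (inj_eq iter_inj).
case: eqP => // _; elim: n {iter_inj} => //= n ->; exact: linear0.
Qed.

(** A small n-th preimage under [T] is placed at [iter n succ j]: its norm is unchanged and [n]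
    steps of [B] bring it back to [j]. *)
Lemma null_and_reachable_delta j (x : X) :
  null_and_reachable T x -> null_and_reachable B (delta j x).
Proof.
move=> [[N xN] xR]; split=> [|e e0].
  exists N => n Nn; apply: c0_eqP => i; rewrite iter_BT deltaE.
  case: eqP => [_|_]; first exact: xN.
  by elim: n {Nn} => //= n ->; exact: linear0.
have [M xM] := xR e e0; exists M => n Mn.
have [w we wx] := xM n Mn.
by exists (delta (iter n succ j) w); rewrite ?delta_norm// iter_BT_delta wx.
Qed.

Lemma BT_mixing : dense [set x | null_and_reachable T x] -> mixing B.
Proof.
move=> dT; apply: (@mixing_criterion K (c0 J X) B BTD).
apply: dense_c0 => [|x y|i x e e0].
- exact: (@null_and_reachable0 K (c0 J X) B BTD).
- exact: (@null_and_reachableD K (c0 J X) B BTD).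
have [||x' [xx' Dx']] := dT (ball x e).
- by exists x; exact: ballxx.
- exact: ball_open.
exists x'; first by move: xx'; rewrite -ball_normE.
exact: null_and_reachable_delta.
Qed.

End BTMixing.

(** * Completeness and the Archimedean property of the scalars *)

Definition complete_scalars (K : numFieldType) : Prop :=
  forall F : set_system K^o, ProperFilter F -> cauchy F -> cvg F.

Definition small_powers (K : numFieldType) : Prop :=
  forall e : K, 0 < e -> exists n, 2^-1 ^+ n < e.

Section Complex.
Context {R : realType}.

Lemma real_small_powers : small_powers R.
Proof.
move=> e e0; exists (Num.Def.archi_bound e^-1).
rewrite exprVn invf_plt ?posrE ?exprn_gt0//.
exact: (upper_nthrootP (leqnn _)).
Qed.

Lemma complex_small_powers : small_powers R[i].
Proof.
move=> e e0; have eE : (complex.Re e)%:C%C = e by rewrite RRe_real// gtr0_real.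
move: e0; rewrite -eE ltcR => /real_small_powers[n ne]; exists n.
by move: ne; rewrite -ltcR rmorphXn /= fmorphV rmorph_nat.
Qed.

Lemma complex_complete : complete_scalars R[i].
Proof.
move=> F FF /cauchy_ballP Fc.
(* [f] will be the real or imaginary part; being dominated by the modulus, it sends [F] to a Cauchy
   filter on [R]. *)
have part (f : R[i] -> R) : (forall x y, f (x - y) = f x - f y) ->
    (forall x, `|f x|%:C%C <= `|x|) -> cvg (f @ F).
  move=> fB fle; apply: cauchy_cvg; apply/cauchy_ballP => e e0.
  rewrite near_map2.
  have e0' : 0 < e%:C%C :> R[i] by rewrite ltcR.
  apply: filterS (Fc _ e0') => -[x y] /=.
  rewrite -!ball_normE /ball_ /= => xy.
  by rewrite -ltcR -fB; apply: le_lt_trans xy.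
have ReF : cvg ((@complex.Re R) @ F).
  by apply: part => [[a b] [c d]//|]; exact: normc_ge_Re.
have ImF : cvg ((@complex.Im R) @ F).
  apply: part => [[a b] [c d]//|x].
  by rewrite normc_def lecR -sqrtr_sqr ler_wsqrtr// lerDr sqr_ge0.
apply/cvg_ex; exists (lim (@complex.Re R @ F) +i* lim (@complex.Im R @ F))%C.
apply/cvgrPdist_le => e e0.
have eE : (complex.Re e)%:C%C = e by rewrite RRe_real// gtr0_real.
move: e0; rewrite -eE ltcR => e0.
have e20 : 0 < complex.Re e / 2 by rewrite divr_gt0.
near=> z.
set a := lim _; set b := lim _.
have -> : (a +i* b)%C - z =
    (a - complex.Re z)%:C%C + 'i%C * (b - complex.Im z)%:C%C.
  by case: (z) => c d; simpc.
rewrite (le_trans (ler_normD _ _))// normrM.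
have -> : `|'i%C : R[i]| = 1 by rewrite normc_def /= expr0n expr1n add0r sqrtr1.
rewrite mul1r !normc_def /= !expr0n /= !addr0 !sqrtr_sqr -rmorphD lecR.
rewrite [leRHS]splitr lerD//; near: z.
- exact: (@cvgr_dist_le _ _ _ F _ _ _ ReF).
- exact: (@cvgr_dist_le _ _ _ F _ _ _ ImF).
Unshelve. all: by end_near. Qed.
End Complex.

(** * The binary tree and its automaton *)

(* [(k, None)] is the state A(k) and [(k, Some m)] is B(k,m). *)
Definition next_state (b : bool) (q : nat * option nat) : nat * option nat :=
  match q with
  | (k, None) => if b then (k, Some (3 * k).+3) else (k.+1, None)
  | (k, Some m.+1) => if b then (0%N, None) else (k, Some m)
  | (_, Some 0%N) => (0%N, None)
  end.

(* The root is [[::]] and the head of a vertex is the last edge taken. *)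
Fixpoint state (w : seq bool) : nat * option nat :=
  if w is b :: w' then next_state b (state w') else (0%N, None).

Definition child (v u : seq bool) : bool :=
  if u is _ :: w then w == v else false.

(** The vertex before [b :: w] on a path can only be [w], so uniqueness follows by induction on the
    word. *)
Lemma child_tree : @rooted_directed_tree (seq bool) child [::].
Proof.
elim=> [|b w [p [[pw lw] pU]]].
  exists [::]; split=> // q [+ +]; case/lastP: q => // q u.
  by rewrite rcons_path last_rcons => /andP[_ +] u0; rewrite u0.
exists (rcons p (b :: w)); split.
  by rewrite rcons_path last_rcons pw lw /= eqxx.
move=> q [+ +]; case/lastP: q => // q u.
rewrite rcons_path last_rcons => /andP[qp +] uw.
by rewrite uw /= => /eqP wl; rewrite (pU q).
Qed.

(** * The weighted shift on the tree *)

Section Tree.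
Context {K : numFieldType}.
Local Notation V := (seq bool).
Local Notation c0V := (c0 V K^o).

(** The weight of the edge from a vertex in state [q] to its child [b]. *)
Definition gain (b : bool) (q : nat * option nat) : K :=
  match q with
  | (_, None) => if b then 1 else 4^-1
  | (k, Some m.+1) => if b then 2^-1 ^+ (3 * k + 7) else 2
  | (k, Some 0%N) => 2^-1 ^+ (3 * k + 7)
  end.

Definition weight (v : V) : K := if v is b :: w then gain b (state w) else 1.

Lemma gain_gt0 b q : 0 < gain b q.
Proof.
by case: q => k [[|m]|]; case: b; rewrite /= ?exprn_gt0 ?invr_gt0 ?ltr0n.
Qed.

Lemma gain_le2 b q : gain b q <= 2.
Proof.
have h n : (2^-1 : K) ^+ n <= 2.
  apply: (@le_trans _ _ 1); last by rewrite ler1n.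
  by rewrite exprn_ile1 ?invr_ge0 ?invf_le1 ?ler1n.
case: q => k [[|m]|]; case: b; rewrite /= ?h ?lexx ?ler1n//.
by rewrite (@le_trans _ _ 1) ?ler1n// invf_le1 ?ler1n ?ltr0n.
Qed.

Lemma weight_neq0 v : weight v != 0.
Proof. by case: v => [|b w]; rewrite ?oner_eq0// gt_eqF ?gain_gt0. Qed.

Definition shift_fun (x : V -> K) (w : V) : K :=
  gain true (state w) * x (true :: w) + gain false (state w) * x (false :: w).

Lemma shift_fun_le x w M : (forall b, `|x (b :: w)| <= M) ->
  `|shift_fun x w| <= 4 * M.
Proof.
move=> xM; rewrite (le_trans (ler_normD _ _))// !normrM.
rewrite -[4]/(2 + 2)%:R natrD mulrDl.
by rewrite lerD// ler_pM// gtr0_norm ?gain_gt0 ?gain_le2.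
Qed.

Lemma shift_subproof (x : c0V) : (shift_fun x : V -> K^o) \in @c0_pred K V K^o.
Proof.
apply/asboolP => e e0.
(* If both children have entries below e/8, the value at [w] is at most 4 (e/8) < e. *)
have e8 : 0 < e / 8 by rewrite divr_gt0.
pose F b := (cons b) @^-1` [set v | e / 8 <= `|x v|].
have FF b : finite_set (F b).
  by apply: finite_preimage; [move=> ? ? _ _ []|exact: c0P].
apply: (@sub_finite_set _ _ (F true `|` F false)); last by rewrite finite_setU.
move=> w /= ew; apply: contrapT => /not_orP[/negP tw /negP fw].
have : `|shift_fun x w| <= 4 * (e / 8).
  apply: shift_fun_le => b; rewrite ltW// real_ltNge ?ger0_real ?(ltW e8)//.
  by case: b.
move=> /(le_trans ew); have -> : 4 * (e / 8) = e / 2 by field.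
by rewrite ler_pdivlMr// ger_pMr// (ler_nat _ 2 1).
Qed.

Definition shift (x : c0V) : c0V := C0 (shift_subproof x).

Lemma shiftE x w : shift x w =
  gain true (state w) * x (true :: w) + gain false (state w) * x (false :: w).
Proof. by []. Qed.

Lemma shift_linear : linear shift.
Proof.
move=> a x y; apply: c0_eqP => w.
have cE (u v : c0V) i : (a *: u + v) i = a * u i + v i by [].
by rewrite cE !shiftE !cE; ring.
Qed.

HB.instance Definition _ :=
  @GRing.isLinear.Build K c0V c0V _ shift shift_linear.

Lemma shift_bounded : bounded_near shift (nbhs (0 : c0V)).
Proof.
apply/linear_boundedP; exists 4; split; first exact: realn.
move=> r r4 x; apply: (@le_trans _ _ (4 * `|x|));
  last by rewrite ler_wpM2r// ltW.
apply: c0_norm_le => [|w]; first by rewrite mulr_ge0.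
by apply: shift_fun_le => b; exact: (c0_norm_ge x).
Qed.

Lemma shift_weighted : weighted_shift child weight shift.
Proof.
move=> x v A /nbhs_singleton Av.
(* Finite sets containing both children already give the full sum, so the net is eventually
   constant. *)
exists [fset (true :: v); (false :: v)]%fset => // B /=.
rewrite fsubUset !fsub1set => /andP[tB fB].
suff -> : partial_sum (fun u => if child v u then weight u * x u else 0) B =
  shift x v by [].
rewrite /partial_sum -(big_seq_fsetE _ _ xpredT
  (fun u => if child v u then weight u * x u else 0)) /=.
rewrite (bigD1_seq _ tB (fset_uniq B))/= -big_filter.
rewrite (bigD1_seq (false :: v)) ?filter_uniq ?fset_uniq ?mem_filter//=.
rewrite eqxx big1_seq ?addr0// => -[//|b u].
rewrite mem_filter => /andP[uf /andP[ut _]] /=; case: eqVneq => // uv.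
by move: ut uf; rewrite uv; case: b; rewrite eqxx.
Qed.

Lemma shift_delta b w (a : K^o) :
  shift (delta (b :: w) a) = delta w (gain b (state w) * a : K^o).
Proof.
apply: c0_eqP => v; rewrite shiftE !deltaE !eqseq_cons.
by case: b; rewrite /=; case: eqVneq => [->|_]; rewrite /= !mulr0 ?addr0 ?add0r.
Qed.

Lemma shift_delta_nil (a : K^o) : shift (delta [::] a) = 0.
Proof. by apply: c0_eqP => v; rewrite shiftE !deltaE /= !mulr0 addr0. Qed.

(** * Products of weights along paths, and small preimages *)

(** The product of the weights on the path from [w] down to [z ++ w], the weight of [w] itself
    excluded. *)
Fixpoint path_gain (z w : V) : K :=
  if z is b :: z' then gain b (state (z' ++ w)) * path_gain z' w else 1.

Lemma path_gain_cons b z w :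
  path_gain (b :: z) w = gain b (state (z ++ w)) * path_gain z w.
Proof. by []. Qed.

Lemma path_gain_gt0 z w : 0 < path_gain z w.
Proof. by elim: z => //= b z IH; rewrite mulr_gt0 ?gain_gt0. Qed.

Lemma path_gain_cat y z w :
  path_gain (y ++ z) w = path_gain y (z ++ w) * path_gain z w.
Proof. by elim: y => [|b y IH] /=; rewrite ?mul1r// IH mulrA catA. Qed.

Lemma iter_shift_delta z w (a : K^o) :
  iter (size z) shift (delta (z ++ w) a) = delta w (path_gain z w * a : K^o).
Proof.
elim: z a => [|b z IH] a /=; first by rewrite mul1r.
by rewrite -iterS iterSr shift_delta IH mulrA [gain _ _ * _]mulrC.
Qed.

Lemma state_falses k w : state w = (0%N, None) ->
  state (nseq k false ++ w) = (k, None).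
Proof. by move=> w0; elim: k => //= k ->. Qed.

Lemma path_gain_falses k w : state w = (0%N, None) ->
  path_gain (nseq k false) w = 4^-1 ^+ k.
Proof.
move=> w0; elim: k => // k IH; rewrite -[nseq _ _]/(false :: nseq k false).
by rewrite path_gain_cons (state_falses k w0) IH exprS.
Qed.

Lemma state_climb k i w m : state w = (k, Some (i + m)%N) ->
  state (nseq i false ++ w) = (k, Some m).
Proof.
by elim: i m => [|i IH] m //= wk; rewrite (IH m.+1) ?addnS.
Qed.

Lemma path_gain_climb k i w m : state w = (k, Some (i + m)%N) ->
  path_gain (nseq i false) w = 2 ^+ i.
Proof.
elim: i m => // i IH m wk; rewrite -[nseq _ _]/(false :: nseq i false).
by rewrite path_gain_cons (@state_climb k _ _ m.+1) ?(IH m.+1) ?addnS// exprS.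
Qed.

Lemma path_gain_growth n w : state w = (0%N, None) ->
  exists2 z, size z = n.+1 & 2 ^+ (n %/ 4) <= path_gain z w.
Proof.
move=> w0; pose k := (n %/ 4)%N; pose i := (n - k)%N.
have kn : (k <= n)%N by rewrite /k leq_div.
(* Read from the right: [k] steps along A-states, one into the climb, then [i] climbing steps. *)
exists (nseq i false ++ true :: nseq k false).
  by rewrite size_cat /= !size_nseq addnS /i subnK.
rewrite path_gain_cat path_gain_cons (state_falses k w0) mul1r.
(* The starting height 3k+3 is at least [i] because n <= 4k+3. *)
rewrite (path_gain_falses k w0) (@path_gain_climb k _ _ ((3 * k).+3 - i)%N);
    last first.
  rewrite subnKC; last by rewrite /i /k; lia.
  by rewrite -[state _]/(next_state true (state (nseq k false ++ w)))
    state_falses.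
(* Of the at least 3k doublings, 2k cancel 4^-k and k others give the bound. *)
have -> : i = (k + (k * 2 + (i - 3 * k)))%N by rewrite /i /k; lia.
rewrite (exprD _ k) exprD exprM (exprAC _ k) -!mulrA ler_peMr ?exprn_ge0//.
rewrite mulrCA -exprMn.
have -> : 2 ^+ 2 * 4^-1 = 1 :> K by field.
by rewrite expr1n mulr1 exprn_ege1// ler1n.
Qed.

(** The [true] child of a B-state is reset; from an A-state a first [true] enters a climb. *)
Lemma state_reset v : exists z, state (z ++ v) = (0%N, None).
Proof.
case vk: (state v) => [k [m|]]; last by exists [:: true; true]; rewrite /= vk.
by exists [:: true]; rewrite /= vk /=; case: m {vk}.
Qed.

Hypothesis archi : small_powers K.

Lemma shift_null_and_reachable v (a : K^o) :
  null_and_reachable shift (delta v a).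
Proof.
split=> [|e e0].
  exists (size v).+1 => n vn.
  (* [size v] steps bring the vector to the root and one more kills it. *)
  have -> : n = ((n - (size v).+1) + (1 + size v))%N by lia.
  have va := iter_shift_delta v [::] a; rewrite cats0 in va.
  rewrite !iterD va /= shift_delta_nil.
  by elim: (n - _)%N => //= i ->; exact: linear0.
(* The path below [v] first reaches a reset vertex [y ++ v], at the fixed cost [path_gain y v], and
   then grows. *)
have [y yv] := state_reset v.
have y0 : 0 < path_gain y v := path_gain_gt0 y v.
have a1 : 0 < `|a| + 1 by rewrite ltr_wpDl.
have [N] := archi (divr_gt0 (mulr_gt0 e0 y0) a1); rewrite ltr_pdivlMr// => aN.
(* Then [(n - size y).-1] is at least 4N, so the growing path gains at least 2^N. *)
exists (4 * N + size y).+1 => n Nn.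
have [z zn zg] := path_gain_growth (n - size y).-1 yv.
have zyn : size (z ++ y) = n by rewrite size_cat zn; lia.
exists (delta ((z ++ y) ++ v) (a / path_gain (z ++ y) v : K^o)); last first.
  rewrite -{1}zyn iter_shift_delta mulrC divfK//.
  by rewrite gt_eqF// path_gain_gt0.
rewrite delta_norm normrM normfV (gtr0_norm (path_gain_gt0 _ _)).
rewrite ltr_pdivrMr ?path_gain_gt0// path_gain_cat mulrCA.
have a2 : `|a| < 2 ^+ N * (e * path_gain y v).
  rewrite -ltr_pdivrMl ?exprn_gt0// -exprVn.
  by apply: le_lt_trans aN; rewrite ler_wpM2l ?exprn_ge0 ?invr_ge0// lerDl.
apply: (lt_le_trans a2); rewrite mulrC (mulrC (path_gain z _)) ler_wpM2l//.
  by rewrite mulr_ge0// ltW.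
apply: le_trans zg; rewrite ler_weXn2l ?ler1n//; lia.
Qed.

Lemma shift_dense : dense [set x : c0V | null_and_reachable shift x].
Proof.
apply: dense_c0 => [|x y|v x e e0].
- exact: (null_and_reachable0 (linearD shift)).
- exact: (null_and_reachableD (linearD shift)).
by exists x; rewrite ?subrr ?normr0//; exact: shift_null_and_reachable.
Qed.

(** * Bounded backward orbits and the absence of chaos *)

Lemma backward_orbit_root (z : nat -> c0V) (C : K) :
  (forall n, z n = shift (z n.+1)) -> (forall n, `|z n| <= C) ->
  z 0%N [::] = 0.
Proof.
move=> zS zC.
have C0 : 0 <= C := le_trans (normr_ge0 _) (zC 0%N).
(* [D] must serve all n at once, since bounding z_n uses later terms of the orbit. *)
have contraction D : 0 <= D ->
    (forall n w k, state w = (k, None) -> `|z n w| <= D) ->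
    forall n w k, state w = (k, None) -> `|z n w| <= 2^-1 * D.
  move=> D0 zD n w k wk.
  (* The -1 closes the induction: 2 (2^(m+2) - 1) + 1 = 2^(m+3) - 1, where the summand 1 comes from
     the reset child. *)
  have climb m n' w' : state w' = (k, Some m) ->
      `|z n' w'| <= (2 ^+ m.+2 - 1) * (2^-1 ^+ (3 * k + 7) * D).
    pose d := 2^-1 ^+ (3 * k + 7) : K.
    have d0 : 0 <= d by rewrite exprn_ge0// invr_ge0.
    elim: m n' w' => [|m IH] n' w' wm; rewrite zS shiftE wm /= -/d.
      have -> : (2 ^+ 2 - 1) * (d * D) = d * D + d * D + d * D by ring.
      rewrite (le_trans (ler_normD _ _))// !normrM (ger0_norm d0).
      apply: (@le_trans _ _ (d * D + d * D)); last by rewrite lerDl mulr_ge0.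
      by rewrite lerD// ler_wpM2l// (zD _ _ 0%N)//= wm.
    have -> : (2 ^+ m.+3 - 1) * (d * D) =
        d * D + 2 * ((2 ^+ m.+2 - 1) * (d * D)).
      by rewrite [2 ^+ m.+3]exprS; ring.
    rewrite (le_trans (ler_normD _ _))// !normrM (ger0_norm d0) normr_nat.
    by rewrite lerD// ler_wpM2l// ?IH ?(zD _ _ 0%N)//= wm.
  rewrite zS shiftE wk /= mul1r (le_trans (ler_normD _ _))//.
  have -> : 2^-1 * D = 4^-1 * D + 4^-1 * D by field.
  rewrite normrM ger0_norm ?invr_ge0// lerD//; last first.
    by rewrite ler_wpM2l ?invr_ge0// (zD _ _ k.+1)//= wk.
  apply: le_trans (climb (3 * k).+3 _ _ _) _; first by rewrite /= wk.
  rewrite mulrA ler_wpM2r//.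
  (* The exponent 3k+7 fits here: the climb from height 3k+3 costs 2^(3k+5), which leaves 1/4. *)
  have -> : (4^-1 : K) = 2 ^+ (3 * k).+3.+2 * 2^-1 ^+ (3 * k + 7).
    have -> : (3 * k + 7 = (3 * k).+3.+2 + 2)%N by lia.
    rewrite exprD mulrA -exprMn mulfV ?pnatr_eq0// expr1n mul1r.
    by rewrite exprVn -natrX.
  by rewrite ler_wpM2r ?exprn_ge0 ?invr_ge0// lerBlDr lerDl.
have zi i n w k : state w = (k, None) -> `|z n w| <= 2^-1 ^+ i * C.
  elim: i n w k => [|i IH] n w k wk.
    by rewrite mul1r (le_trans _ (zC n))//; exact: c0_norm_ge.
  rewrite exprS -mulrA; apply: contraction IH _ _ _ wk.
  by rewrite mulr_ge0// exprn_ge0// invr_ge0.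
(* Otherwise 2^-m (C + 1) drops below the modulus at the root for some m; the added 1 covers C =
   0. *)
apply/eqP; rewrite -normr_le0 real_leNgt ?normr_real ?real0//.
apply/negP => z0.
have C1 : 0 < C + 1 by rewrite ltr_wpDl.
have [m] := archi (divr_gt0 z0 C1).
rewrite ltr_pdivlMr// => mz.
have /lt_le_trans/(_ (zi m 0%N [::] 0%N erefl)) := mz.
by rewrite ltr_pM2l ?exprn_gt0 ?invr_gt0// gtrDl ltr10.
Qed.

End Tree.

(** As d - 1 is -1 modulo d, the iterates of order (d-1)n run backwards along the cycle; the sum of
    the norms over a period bounds them. *)
Lemma periodic_backward_orbit (K : numFieldType) (Y : normedModType K)
    (S : Y -> Y) (x : Y) : periodic S x ->
  exists z (C : K), [/\ z 0%N = x, forall n, z n = S (z n.+1) &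
    forall n, `|z n| <= C].
Proof.
move=> [d d0 Sx]; exists (fun n => iter (d.-1 * n) S x).
exists (\sum_(i < d) `|iter i S x|).
have iterMd m : iter (m * d) S x = x.
  by elim: m => // m IH; rewrite mulSn iterD IH.
split=> [|n|n]; first by rewrite muln0.
  rewrite -iterS; have -> : (d.-1 * n.+1).+1 = (d.-1 * n + 1 * d)%N by lia.
  by rewrite iterD iterMd.
rewrite [X in iter X](divn_eq _ d) addnC iterD iterMd.
rewrite (bigD1 (Ordinal (ltn_pmod (d.-1 * n) d0)))//= lerDl.
by apply: sumr_ge0 => i _; exact: normr_ge0.
Qed.

Section NotChaotic.
Context {K : numFieldType}.
Hypothesis archi : small_powers K.
Local Notation V := (seq bool).
Local Notation c0V := (c0 V K^o).

(** Periodic points vanish at the root, hence stay at distance at least 1 from the unit vector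
    there. *)
Lemma shift_not_chaotic : ~ chaotic (@shift K).
Proof.
move=> [_ dP]; pose e := delta [::] (1 : K^o) : c0V.
have [||x [ex px]] := dP (ball e 1).
- by exists e; exact: ballxx.
- exact: ball_open.
have [z [C [z0 zS zC]]] := periodic_backward_orbit px.
have := c0_coord_lt [::] ex.
rewrite -z0 (backward_orbit_root archi zS zC).
by rewrite deltaE subr0 normr1 ltxx.
Qed.

Lemma BT_shift_not_chaotic (J : choiceType) (j : J) (succ : J -> J)
    (succ_inj : injective succ) :
  ~ chaotic (BT succ_inj (@shift_bounded K)).
Proof.
move=> [_ dP]; pose e := delta j (delta [::] (1 : K^o)) : c0 J c0V.
have [||x [ex px]] := dP (ball e 1).
- by exists e; exact: ballxx.
- exact: ball_open.
have [z [C [z0 zS zC]]] := periodic_backward_orbit px.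
have : `|e j - x j| < 1 := c0_coord_lt j ex.
apply/negP; rewrite -real_leNgt ?normr_real ?real1//.
apply: le_trans (c0_norm_ge (e j - x j) [::]).
have -> : (e j - x j) [::] = e j [::] - x j [::] by [].
(* Along this diagonal [BT] acts as [shift], since it computes coordinate [k] from coordinate
   [succ k]. *)
rewrite -z0 (@backward_orbit_root _ archi (fun n => z n (iter n succ j)) C).
- by rewrite !deltaE eqxx deltaE subr0 normr1.
- by move=> n; rewrite zS.
- by move=> n; apply: le_trans (c0_norm_ge _ _) (zC n).
Qed.

End NotChaotic.

(** * The example over complete scalars *)

Section Scalars.
Context {K : numFieldType}.
Hypotheses (archi : small_powers K) (complete : complete_scalars K).

(** [K] is an abstract field here, so completeness of the scalars, and then of [c0], is attached
    from the hypothesis [complete]. *)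
Let Kc : completeNormedModType K :=
  HB.pack K^o (Uniform_isComplete.Build K^o complete).

Let c0c : completeNormedModType K :=
  HB.pack (c0 (seq bool) K^o)
    (Uniform_isComplete.Build (c0 (seq bool) K^o)
      (@c0_complete K (seq bool) Kc)).

Lemma shift_example (J : choiceType) (j : J) (succ : J -> J)
    (succ_inj : injective succ) :
  exists (X : completeNormedModType K) (T : {linear X -> X})
      (T_bounded : bounded_near T (nbhs (0 : X))),
    mixing (BT succ_inj T_bounded) /\ ~ chaotic (BT succ_inj T_bounded).
Proof.
exists c0c, (@shift K), (@shift_bounded K); split.
  exact: (BT_mixing _ _ (shift_dense archi)).
exact: BT_shift_not_chaotic.
Qed.

End Scalars.

Theorem proposition3p10 (R : realType) (K : numFieldType)
    (K_scalars : K = R :> numFieldType \/ K = R[i] :> numFieldType) :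
  (exists (V : countType) (E : rel V) (root : V) (lambda : V -> K)
      (S : {linear c0 V K^o -> c0 V K^o}),
    rooted_directed_tree E root /\
    (forall v, lambda v != 0) /\
    bounded_near S (nbhs (0 : c0 V K^o)) /\
    weighted_shift E lambda S /\
    mixing S /\ ~ chaotic S) /\
  (exists (X : completeNormedModType K) (T : {linear X -> X})
      (T_bounded : bounded_near T (nbhs (0 : X))),
    mixing (BT pnat_succ_inj T_bounded) /\
    ~ chaotic (BT pnat_succ_inj T_bounded)) /\
  (exists (X : completeNormedModType K) (T : {linear X -> X})
      (T_bounded : bounded_near T (nbhs (0 : X))),
    mixing (BT int_succ_inj T_bounded) /\
    ~ chaotic (BT int_succ_inj T_bounded)).
Proof.
have [archi complete] : small_powers K /\ complete_scalars K.
  case: K_scalars => ->; split.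
  - exact: real_small_powers.
  - by move=> F FF; exact: (@R_complete R).
  - exact: complex_small_powers.
  - exact: complex_complete.
split; last first.
  by split; apply: (shift_example archi complete);
    [exact: (exist _ 1%N isT)|exact: 0].
exists (seq bool), child, [::], (@weight K), (@shift K); split.
  exact: child_tree.
split; first exact: weight_neq0.
split; first exact: shift_bounded.
split; first exact: shift_weighted.
split; last exact: shift_not_chaotic archi.
exact: (@mixing_criterion K (c0 (seq bool) K^o) _ (linearD (@shift K))
  (shift_dense archi)).
Qed.
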